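(* Let $0\le\alpha<1$ and $0<\beta\le 1$. Let $p,b,c\in\mathbb{C}$ be such that $c$ is real with $c<0$ and $p+\frac{b+1}{2}$ is real with $p+\frac{b+1}{2}>0$. Assume that $$2\beta(1-\alpha)\left[2-e^{\frac{-c}{p+\frac{b+1}{2}+1}}+\frac{1}{p+\frac{b+1}{2}}\left(1-e^{\frac{-c}{p+\frac{b+1}{2}+1}}\right)\right]-\frac{(1+\beta)(-c)}{p+\frac{b+1}{2}}\,e^{\frac{-c}{p+\frac{b+1}{2}+1}}\ \ge\ 0 .$$ Then $u_{p,b,c}\in S^{\ast}(\alpha,\beta)$.
   Context: $U=\{z\in\mathbb{C}:|z|<1\}$ and $\mathcal{A}$ is the class of analytic functions $f$ on $U$ of the form $f(z)=z+\sum_{k=2}^{\infty}a_kz^k$. For $0\le\alpha<1$, $0<\beta\le1$, $S^{\ast}(\alpha,\beta)$ is the class of $f\in\mathcal{A}$ satisfying $\left|\dfrac{\frac{zf'(z)}{f(z)}-1}{\frac{zf'(z)}{f(z)}+(1-2\alpha)}\right|<\beta$ for all $z\in U$. The normalized generalized Bessel function is $$u_{p,b,c}(z)=\sum_{k=0}^{\infty}\frac{(-c)^k}{\left(p+\frac{b+1}{2}\right)_k}\frac{z^{k+1}}{k!},\qquad p,b,c\in\mathbb{C},\ p+\tfrac{b+1}{2}\notin\{0,-1,-2,\dots\},$$ where $(\lambda)_0=1$ and $(\lambda)_k=\lambda(\lambda+1)\cdots(\lambda+k-1)$ for $k\ge1$. *)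

(* Defs.v *)
From Stdlib Require Import Reals Factorial.
From Coquelicot Require Import Coquelicot.

Local Open Scope C_scope.

Definition unit_disc (z : C) : Prop := (Cmod z < 1)%R.

(* Functions on the disc are total maps [C -> C]; only their values on the disc
   are constrained. *)
Definition class_A (f : C -> C) : Prop :=
  (forall z : C, unit_disc z ->
     ex_derive (K := C_AbsRing) (V := C_NormedModule) f z) /\
  exists a : nat -> C, forall z : C, unit_disc z ->
    is_series (K := C_AbsRing) (V := C_NormedModule)
      (fun k : nat => a (k + 2)%nat * z ^ (k + 2)) (f z - z).

(* [z f'(z) / f(z)], where the removable singularity at [0] of a function of
   [class_A] is filled with the limit value [1]. *)
Definition star_quotient (f : C -> C) (z : C) : C :=
  if Ceq_dec z 0 then 1 else z * C_derive f z / f z.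

(* Division is total in Rocq, so the two non-vanishing conditions, implicit in
   the usual notation, say that both quotients are defined. *)
Definition class_Sstar (alpha beta : R) (f : C -> C) : Prop :=
  class_A f /\
  forall z : C, unit_disc z ->
    (z <> 0 -> f z <> 0) /\
    star_quotient f z + (1 - 2 * RtoC alpha) <> 0 /\
    (Cmod ((star_quotient f z - 1) /
           (star_quotient f z + (1 - 2 * RtoC alpha))) < beta)%R.

Fixpoint Cpochhammer (l : C) (k : nat) : C :=
  match k with
  | O => 1
  | S k' => Cpochhammer l k' * (l + RtoC (INR k'))
  end.

(* Sum of a complex series, taken on real and imaginary parts; it is the
   actual sum of every convergent series, by [CSeries_unique]. *)
Definition CSeries (a : nat -> C) : C :=
  (Series (fun n => Re (a n)), Series (fun n => Im (a n))).

Lemma CSeries_unique (a : nat -> C) (l : C) :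
  is_series (K := C_AbsRing) (V := C_NormedModule) a l -> CSeries a = l.
Proof.
intros H.
assert (H1 : is_series (fun n => Re (a n)) (Re l)).
{ unfold is_series in *.
  apply filterlim_ext with (fun n => fst (sum_n (G := C_AbelianMonoid) a n)).
  { intros n; induction n as [|n IH].
    - now rewrite !sum_O.
    - now rewrite !sum_Sn, <- IH. }
  eapply filterlim_comp; [exact H|].
  exact (@continuous_fst R_UniformSpace R_UniformSpace (fst l) (snd l)). }
assert (H2 : is_series (fun n => Im (a n)) (Im l)).
{ unfold is_series in *.
  apply filterlim_ext with (fun n => snd (sum_n (G := C_AbelianMonoid) a n)).
  { intros n; induction n as [|n IH].
    - now rewrite !sum_O.
    - now rewrite !sum_Sn, <- IH. }
  eapply filterlim_comp; [exact H|].
  exact (@continuous_snd R_UniformSpace R_UniformSpace (fst l) (snd l)). }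
unfold CSeries.
rewrite (is_series_unique _ _ H1), (is_series_unique _ _ H2).
now destruct l.
Qed.

Definition bessel_param (p b : C) : C := p + (b + 1) / 2.

Definition bessel_u (p b c z : C) : C :=
  CSeries (fun k : nat =>
    (- c) ^ k / Cpochhammer (bessel_param p b) k
      * (z ^ (k + 1) / RtoC (INR (fact k)))).

(* Main.v *)
(* Write x = - c, k = p + (b + 1) / 2 and u(z) = sum_n A_n z^(n+1), where
   A_n = x^n / ((k)_n n!) >= 0.  With P = sum_(n>=1) A_n z^n and
   Q = sum_(n>=1) n A_n z^n one has u = z (1 + P) and u' = 1 + P + Q, so the
   quotient to bound is Q / (2 (1 - alpha) (1 + P) + Q).  By the triangle
   inequality and |z| < 1 its modulus is below beta as soon as
     (1 + beta) sum_n n A_n + 2 beta (1 - alpha) sum_(n>=1) A_n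
       <= 2 beta (1 - alpha).
   Since (k)_(n+1) >= k (k + 1)^n, both sums are dominated by exponential
   series: sum_n n A_n <= (x / k) E and
   sum_(n>=1) A_n <= ((k + 1) / k) (E - 1), with E = exp (x / (k + 1)), and the
   hypothesis is exactly the resulting inequality. *)

Require Import Defs.
From Stdlib Require Import Reals.
From Stdlib Require Import Factorial Lra Lia.
From Coquelicot Require Import Coquelicot.
Local Open Scope R_scope.

(** * Complex series: modulus bounds and differentiation term by term *)

Notation is_Cseries := (is_series (K := C_AbsRing) (V := C_NormedModule)).

Lemma is_Cseries_Cmod_le (a : nat -> C) (b : nat -> R) (l : C) (s : R) :
  (forall n, Cmod (a n) <= b n) -> is_Cseries a l -> is_series b s ->
  Cmod l <= s.
Proof.
intros Hab Ha Hb.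
assert (Hsum : forall n,
  Cmod (sum_n (G := C_AbelianMonoid) a n) <= sum_n b n).
{ intros n; induction n as [|n IH].
  - rewrite !sum_O; apply Hab.
  - rewrite !sum_Sn; eapply Rle_trans; [apply Cmod_triangle|].
    apply Rplus_le_compat; [exact IH|apply Hab]. }
apply (filterlim_le (F := eventually)
  (fun n => Cmod (sum_n (G := C_AbelianMonoid) a n)) (sum_n b)
  (Finite (Cmod l)) (Finite s)).
- apply filter_forall; exact Hsum.
- eapply filterlim_comp; [exact Ha|].
  apply (filterlim_norm (K := C_AbsRing) (V := C_NormedModule) l).
- exact Hb.
Qed.

Lemma Cmod_INR (n : nat) : Cmod (RtoC (INR n)) = INR n.
Proof. rewrite Cmod_R; apply Rabs_pos_eq, pos_INR. Qed.

Lemma pow_le_1 (x : R) (n : nat) : 0 <= x <= 1 -> x ^ n <= 1.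
Proof. intros H; rewrite <- (pow1 n); apply pow_incr; lra. Qed.

(** Second-order Taylor remainder of a monomial, uniform on the closed disc. The crude constant
    [INR (n + 1) ^ 2] suffices because the coefficients will be summable against it. *)
Lemma Cpow_taylor_bound (z w : C) (n : nat) :
  Cmod z <= 1 -> Cmod w <= 1 ->
  Cmod (w ^ (n + 1) - z ^ (n + 1) - RtoC (INR (n + 1)) * z ^ n * (w - z))%C
    <= INR (n + 1) ^ 2 * Cmod (w - z) ^ 2.
Proof.
intros Hz Hw; rewrite Nat.add_1_r.
assert (Hzw := Cmod_ge_0 (w - z)).
induction n as [|n IH].
- replace (w ^ 1 - z ^ 1 - RtoC (INR 1) * z ^ 0 * (w - z))%C with (RtoC 0)
    by (simpl; ring).
  rewrite Cmod_0; simpl; nra.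
(* With N = n + 1, the remainders satisfy R_(N+1) = w R_N + N z^n (w - z)^2, and N^2 + N <= (N +
   1)^2 closes the induction. *)
- replace (w ^ S (S n) - z ^ S (S n)
      - RtoC (INR (S (S n))) * z ^ S n * (w - z))%C
    with (w * (w ^ S n - z ^ S n - RtoC (INR (S n)) * z ^ n * (w - z))
      + RtoC (INR (S n)) * z ^ n * ((w - z) * (w - z)))%C
    by (rewrite (S_INR (S n)), RtoC_plus, !Cpow_S; ring).
  eapply Rle_trans; [apply Cmod_triangle|].
  rewrite !Cmod_mult, Cmod_pow, Cmod_INR, (S_INR (S n)).
  assert (Hp : Cmod z ^ n <= 1)
    by (apply pow_le_1; split; [apply Cmod_ge_0|exact Hz]).
  assert (Hp0 : 0 <= Cmod z ^ n) by (apply pow_le, Cmod_ge_0).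
  assert (HN := pos_INR (S n)).
  assert (H0 := Cmod_ge_0 w).
  assert (H1 := Cmod_ge_0
    (w ^ S n - z ^ S n - RtoC (INR (S n)) * z ^ n * (w - z))).
  set (T := Cmod (w ^ S n - _ - _)) in *.
  set (d := Cmod (w - z)) in *.
  set (N := INR (S n)) in *.
  assert (A1 : Cmod w * T <= N ^ 2 * d ^ 2) by nra.
  assert (A2 : N * Cmod z ^ n * (d * d) <= N * (d * d)).
  { apply Rmult_le_compat_r; [nra|].
    rewrite <- (Rmult_1_r N) at 2; apply Rmult_le_compat_l; lra. }
  assert (0 <= d * d) by nra.
  nra.
Qed.

(** Summing the monomial remainders gives |f w - f z - (w - z) l| <= M |w - z|^2 on the disc, so
    differentiability follows straight from the definition. *)
Lemma is_Cderive_Cseries (f : C -> C) (a : nat -> C) (z l : C) :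
  (forall w, unit_disc w -> is_Cseries (fun n => a n * w ^ (n + 1))%C (f w)) ->
  ex_series (fun n => INR (n + 1) ^ 2 * Cmod (a n)) ->
  unit_disc z ->
  is_Cseries (fun n => RtoC (INR (n + 1)) * a n * z ^ n)%C l ->
  is_derive (K := C_AbsRing) (V := C_NormedModule) f z l.
Proof.
intros Hf [M HM] Hz Hl.
assert (Hquad : forall w, unit_disc w ->
  Cmod (f w - f z - (w - z) * l)%C <= Cmod (w - z) ^ 2 * M).
{ intros w Hw.
  refine (is_Cseries_Cmod_le (fun n => a n *
      (w ^ (n + 1) - z ^ (n + 1) - RtoC (INR (n + 1)) * z ^ n * (w - z)))%C
    (fun n => Cmod (w - z) ^ 2 * (INR (n + 1) ^ 2 * Cmod (a n))) _ _ _ _ _).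
  - intros n; rewrite Cmod_mult.
    assert (H := Cpow_taylor_bound z w n (Rlt_le _ _ Hz) (Rlt_le _ _ Hw)).
    assert (Ha := Cmod_ge_0 (a n)).
    nra.
  - assert (H1 := is_series_minus _ _ _ _ (Hf w Hw) (Hf z Hz)).
    assert (H2 := is_series_scal_l (w - z)%C _ _ Hl).
    assert (H3 := is_series_minus _ _ _ _ H1 H2).
    eapply is_series_ext; [|exact H3].
    intros n; unfold minus, scal, plus, opp, mult; simpl.
    unfold mult; simpl; ring.
  - apply (is_series_scal_l (Cmod (w - z) ^ 2) _ _ HM). }
assert (HM1 := Rle_abs M); assert (HM0 := Rabs_pos M).
split; [apply is_linear_scal_l|].
intros x Hx.
(* The differential is tested at every limit point of the filter [locally z]; the only one is
   [z]. *)
apply (is_filter_lim_locally_unique (K := C_AbsRing)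
  (V := AbsRing_NormedModule C_AbsRing)) in Hx.
subst x; intros eps.
(* The first radius keeps [w] in the disc; the second makes M |w - z| at most [eps], with
   [Rabs M + 1] as a positive denominator. *)
assert (Hd : 0 < Rmin (1 - Cmod z) (eps / (Rabs M + 1))).
{ unfold unit_disc in Hz; apply Rmin_pos; [lra|].
  apply Rdiv_lt_0_compat; [apply cond_pos|lra]. }
apply (locally_le_locally_norm (K := C_AbsRing)
  (V := AbsRing_NormedModule C_AbsRing)).
exists (mkposreal _ Hd).
intros w Hw; unfold ball_norm in Hw.
change (Cmod (w - z) < Rmin (1 - Cmod z) (eps / (Rabs M + 1))) in Hw.
change (Cmod (f w - f z - (w - z) * l)%C <= eps * Cmod (w - z)).
assert (H1 := Rlt_le_trans _ _ _ Hw (Rmin_l _ _)).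
assert (H2 := Rlt_le_trans _ _ _ Hw (Rmin_r _ _)).
assert (H3 : unit_disc w).
{ unfold unit_disc; replace w with ((w - z) + z)%C by ring.
  eapply Rle_lt_trans; [apply Cmod_triangle|lra]. }
eapply Rle_trans; [exact (Hquad w H3)|].
assert (H4 := Cmod_ge_0 (w - z)).
assert (H5 : Cmod (w - z) * (Rabs M + 1) < eps)
  by (apply Rlt_div_r; [lra|exact H2]).
nra.
Qed.

(** * A coefficient criterion for starlikeness *)

Lemma is_Cseries_decr_1 (a : nat -> C) (l : C) :
  is_Cseries (fun n => a (S n)) l -> is_Cseries a (a 0%nat + l)%C.
Proof.
intros H; apply is_series_decr_1.
match goal with |- is_series _ ?x => replace x with l; [exact H|] end.
unfold plus, opp; simpl; ring.
Qed.

(** Since |z^(n+1)| <= |z|, a factor [Cmod z] comes out of the bound. It later turns a non-strict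
    condition on the coefficients into a strict inequality inside the disc. *)
Lemma ex_Cseries_disc_bound (a : nat -> C) (s : R) (z : C) :
  is_series (fun n => Cmod (a n)) s -> Cmod z <= 1 ->
  exists l, is_Cseries (fun n => a n * z ^ (n + 1))%C l /\ Cmod l <= Cmod z * s.
Proof.
intros Hs Hz.
assert (Hle : forall n,
  Cmod (a n * z ^ (n + 1))%C <= Cmod z * Cmod (a n)).
{ intros n; rewrite Cmod_mult, Cmod_pow, Nat.add_1_r; simpl.
  assert (Hz0 := Cmod_ge_0 z).
  assert (Hp : Cmod z ^ n <= 1) by (apply pow_le_1; lra).
  assert (Hp0 : 0 <= Cmod z ^ n) by (apply pow_le; lra).
  assert (0 <= Cmod z * Cmod (a n))
    by (apply Rmult_le_pos; apply Cmod_ge_0).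
  nra. }
assert (Hs' := is_series_scal_l (Cmod z) _ _ Hs).
destruct (ex_series_le (K := C_AbsRing) (V := C_CompleteNormedModule)
  (fun n => a n * z ^ (n + 1))%C _ Hle (ex_intro _ _ Hs')) as [l Hl].
exists l; split; [exact Hl|].
exact (is_Cseries_Cmod_le _ _ _ _ Hle Hl Hs').
Qed.

(** The triangle inequality argument sees the coefficients only through [s] and [t], so they may be
    arbitrary complex numbers; the quadratic moment serves to differentiate. Here [a n] multiplies
    z^(n+1). *)
Lemma class_Sstar_of_coef_bound (alpha beta : R) (f : C -> C) (a : nat -> C)
    (s t : R) :
  0 <= alpha < 1 -> 0 < beta ->
  a 0%nat = 1%C ->
  (forall z, unit_disc z -> is_Cseries (fun n => a n * z ^ (n + 1))%C (f z)) ->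
  ex_series (fun n => INR (n + 1) ^ 2 * Cmod (a n)) ->
  is_series (fun n => Cmod (a (S n))) s ->
  is_series (fun n => INR (S n) * Cmod (a (S n))) t ->
  (1 + beta) * t + 2 * beta * (1 - alpha) * s <= 2 * beta * (1 - alpha) ->
  class_Sstar alpha beta f.
Proof.
intros Halpha Hbeta Ha0 Hf Hsq Hs Ht Hst.
assert (Hdisc : forall z, unit_disc z -> exists P Q : C,
  is_Cseries (fun n => a (S n) * z ^ (n + 1))%C P /\
  Cmod P <= Cmod z * s /\ Cmod Q <= Cmod z * t /\
  f z = (z * (1 + P))%C /\
  is_derive (K := C_AbsRing) (V := C_NormedModule) f z (1 + P + Q)%C).
{ intros z Hz; assert (Hz1 := Rlt_le _ _ Hz).
  destruct (ex_Cseries_disc_bound (fun n => a (S n)) s z Hs Hz1)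
    as [P [HP HPs]].
  destruct (ex_Cseries_disc_bound (fun n => RtoC (INR (S n)) * a (S n))%C t z)
    as [Q [HQ HQt]]; [|exact Hz1|].
  { eapply is_series_ext; [|exact Ht].
    intros n; now rewrite Cmod_mult, Cmod_INR. }
  exists P, Q; split; [exact HP|split; [exact HPs|split; [exact HQt|split]]].
  (* Both sides are sums of the same series, hence equal by uniqueness. *)
  - rewrite <- (CSeries_unique _ _ (Hf z Hz)).
    apply CSeries_unique.
    replace (z * (1 + P))%C with (a 0%nat * z ^ (0 + 1) + scal z P)%C
      by (rewrite Ha0; unfold scal; simpl; unfold mult; simpl; ring).
    apply is_Cseries_decr_1.
    eapply is_series_ext; [|exact (is_series_scal_l z _ _ HP)].
    intros n; unfold scal; simpl; unfold mult; simpl; ring.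
  - apply (is_Cderive_Cseries f a z _ Hf Hsq Hz).
    replace (1 + P + Q)%C
      with (RtoC (INR (0 + 1)) * a 0%nat * z ^ 0 + plus P Q)%C
      by (rewrite Ha0; change (plus P Q) with (P + Q)%C; simpl; ring).
    apply (is_Cseries_decr_1 (fun n => RtoC (INR (n + 1)) * a n * z ^ n)%C).
    eapply is_series_ext; [|exact (is_series_plus _ _ _ _ HP HQ)].
    (* The factor n + 2 of the shifted derivative series splits as 1 + (n + 1), giving the terms of
       [P] and [Q]. *)
    intros n; rewrite !Nat.add_1_r, (S_INR (S n)), RtoC_plus.
    lazymatch goal with |- plus ?u ?v = ?w => change ((u + v)%C = w :> C) end.
    ring. }
split; [split|].
- intros z Hz; destruct (Hdisc z Hz) as (P & Q & _ & _ & _ & _ & H).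
  now exists (1 + P + Q)%C.
(* The coefficient of z^k is [a (k - 1)]; only indices k >= 2 are read, so truncated subtraction is
   harmless. *)
- exists (fun k => a (k - 1)%nat); intros z Hz.
  destruct (Hdisc z Hz) as (P & Q & HP & _ & _ & Hfz & _).
  rewrite Hfz; replace (z * (1 + P) - z)%C with (scal z P)
    by (unfold scal; simpl; unfold mult; simpl; ring).
  eapply is_series_ext; [|exact (is_series_scal_l z _ _ HP)].
  intros n; replace (n + 2 - 1)%nat with (S n) by lia.
  replace (n + 2)%nat with (S (n + 1)) by lia.
  unfold scal; simpl; unfold mult; simpl; ring.
- intros z Hz; destruct (Hdisc z Hz) as (P & Q & _ & HPs & HQt & Hfz & Hd).
  assert (HC : Cmod (2 * RtoC (1 - alpha))%C = 2 * (1 - alpha)).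
  { rewrite <- RtoC_mult, Cmod_R; apply Rabs_pos_eq; lra. }
  assert (HC0 : (2 * RtoC (1 - alpha))%C <> 0).
  { intros H; rewrite H, Cmod_0 in HC; lra. }
  unfold star_quotient; destruct (Ceq_dec z 0) as [Hz0|Hz0].
  + split; [now intros|].
    replace (1 + (1 - 2 * alpha))%C with (2 * RtoC (1 - alpha))%C
      by (rewrite RtoC_minus; ring).
    split; [exact HC0|].
    replace ((1 - 1) / (2 * RtoC (1 - alpha)))%C with (RtoC 0)
      by (field; intros H; apply HC0; rewrite H; ring).
    now rewrite Cmod_0.
  + rewrite (is_C_derive_unique _ _ _ Hd), Hfz.
    assert (Hr : 0 < Cmod z < 1).
    { split; [now apply Cmod_gt_0|exact Hz]. }
    assert (HP0 := Cmod_ge_0 P); assert (HQ0 := Cmod_ge_0 Q).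
    (* Signs come from |P| <= |z| s and |Q| <= |z| t with |z| > 0. Then [s <= 1] follows from the
       hypothesis, so |P| < 1 and [f z] does not vanish. *)
    assert (Hs0 : 0 <= s) by nra.
    assert (Ht0 : 0 <= t) by nra.
    assert (Hab : 0 < beta * (1 - alpha)) by nra.
    assert (Hs1 : s <= 1) by nra.
    assert (HP1 : Cmod P < 1) by nra.
    assert (HP2 : (1 + P)%C <> 0).
    { intros H; assert (HP : P = (- (1))%C)
        by (replace P with ((1 + P) - 1)%C by ring; rewrite H; ring).
      rewrite HP, Cmod_m1 in HP1; lra. }
    set (D := (2 * RtoC (1 - alpha) * (1 + P) + Q)%C).
    (* [D / (1 + P)] is the denominator of the quotient and [Q / (1 + P)] its numerator. The strict
       bound also forces [D <> 0]. *)
    assert (HQD : Cmod Q < beta * Cmod D).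
    { assert (HD : 2 * (1 - alpha) <=
        Cmod D + Cmod Q + 2 * (1 - alpha) * Cmod P).
      { rewrite <- HC, <- Cmod_mult, <- (Cmod_opp Q).
        rewrite <- (Cmod_opp (_ * P)).
        replace (2 * RtoC (1 - alpha))%C
          with (D + - Q + - (2 * RtoC (1 - alpha) * P))%C at 1
          by (unfold D; ring).
        eapply Rle_trans; [apply Cmod_triangle|].
        apply Rplus_le_compat_r, Cmod_triangle. }
      (* The right-hand side is strictly below 2 beta (1 - alpha) because |z| < 1; combined with
         beta times [HD] this gives |Q| < beta |D|. *)
      assert (H1 : (1 + beta) * Cmod Q + 2 * beta * (1 - alpha) * Cmod P
        <= Cmod z * (2 * beta * (1 - alpha))).
      { assert (Cmod z * ((1 + beta) * t + 2 * beta * (1 - alpha) * s)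
          <= Cmod z * (2 * beta * (1 - alpha))) by nra.
        nra. }
      nra. }
    assert (HD0 : D <> 0).
    { intros H; rewrite H, Cmod_0 in HQD; lra. }
    replace (z * (1 + P + Q) / (z * (1 + P)) - 1)%C with (Q / (1 + P))%C
      by (now field).
    replace (z * (1 + P + Q) / (z * (1 + P)) + (1 - 2 * alpha))%C
      with (D / (1 + P))%C
      by (unfold D; rewrite RtoC_minus; now field).
    split; [|split].
    * intros _; now apply Cmult_neq_0.
    * intros H; apply HD0.
      replace D with (D / (1 + P) * (1 + P))%C by (now field).
      rewrite H; ring.
    * replace (Q / (1 + P) / (D / (1 + P)))%C with (Q / D)%C by (now field).
      rewrite Cmod_div by exact HD0.
      apply Rlt_div_l; [now apply Cmod_gt_0|exact HQD].
Qed.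

(** * Domination of the Bessel coefficients by exponential series *)

Lemma is_series_exp (x : R) :
  is_series (fun n => x ^ n / INR (fact n)) (exp x).
Proof.
eapply is_series_ext; [|exact (is_exp_Reals x)].
intros n; rewrite pow_n_pow; reflexivity.
Qed.

Lemma is_series_le_ex (a b : nat -> R) (s : R) :
  (forall n, 0 <= a n <= b n) -> is_series b s ->
  exists l, is_series a l /\ l <= s.
Proof.
intros H Hb; exists (Series a); split.
- apply Series_correct.
  apply (ex_series_le (K := R_AbsRing) (V := R_CompleteNormedModule) a b).
  + intros n; change (Rabs (a n) <= b n).
    rewrite Rabs_pos_eq; apply H.
  + now exists s.
- rewrite <- (is_series_unique _ _ Hb).
  apply Series_le; [exact H|now exists s].
Qed.

Fixpoint Rpochhammer (k : R) (n : nat) : R :=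
  match n with
  | O => 1
  | S n' => Rpochhammer k n' * (k + INR n')
  end.

Lemma Cpochhammer_RtoC (k : R) (n : nat) :
  Cpochhammer (RtoC k) n = RtoC (Rpochhammer k n).
Proof.
induction n as [|n IH]; [reflexivity|].
simpl; now rewrite IH, RtoC_mult, RtoC_plus.
Qed.

(** The first factor is [k], and each of the [n] later ones is at least [k + 1]. *)
Lemma Rpochhammer_S_ge (k : R) (n : nat) :
  0 < k -> k * (k + 1) ^ n <= Rpochhammer k (S n).
Proof.
intros Hk; induction n as [|n IH]; [simpl; lra|].
change (Rpochhammer k (S (S n))) with (Rpochhammer k (S n) * (k + INR (S n))).
rewrite S_INR, <- tech_pow_Rmult.
assert (Hn := pos_INR n).
assert (H : 0 <= (k + 1) ^ n) by (apply pow_le; lra).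
assert (0 <= k * (k + 1) ^ n) by nra.
nra.
Qed.

Lemma Rpochhammer_pos (k : R) (n : nat) : 0 < k -> 0 < Rpochhammer k n.
Proof.
intros Hk; destruct n as [|n]; [simpl; lra|].
eapply Rlt_le_trans; [|now apply Rpochhammer_S_ge].
apply Rmult_lt_0_compat; [exact Hk|apply pow_lt; lra].
Qed.

(** The A_n of the overview, kept real so that order arguments apply. *)
Definition bessel_coef (k x : R) (n : nat) : R :=
  x ^ n / (Rpochhammer k n * INR (fact n)).

Lemma bessel_coef_nonneg (k x : R) (n : nat) :
  0 < k -> 0 <= x -> 0 <= bessel_coef k x n.
Proof.
intros Hk Hx; apply Rmult_le_pos; [now apply pow_le|].
apply Rlt_le, Rinv_0_lt_compat, Rmult_lt_0_compat;
  [now apply Rpochhammer_pos|apply INR_fact_lt_0].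
Qed.

(** The weight [INR (S n)] cancels against the factorial, and the lower bound on the Pochhammer
    symbol leaves a term of the exponential series. *)
Lemma bessel_coef_S_le (k x : R) (n : nat) :
  0 < k -> 0 <= x ->
  INR (S n) * bessel_coef k x (S n)
    <= x / k * ((x / (k + 1)) ^ n / INR (fact n)).
Proof.
intros Hk Hx; unfold bessel_coef.
assert (Hf := INR_fact_lt_0 n).
assert (Hn : 0 < INR (S n)) by (apply lt_0_INR; lia).
assert (HP := Rpochhammer_S_ge k n Hk).
assert (HK : 0 < (k + 1) ^ n) by (apply pow_lt; lra).
assert (HP0 := Rpochhammer_pos k (S n) Hk).
rewrite fact_simpl, mult_INR.
replace ((x / (k + 1)) ^ n) with (x ^ n / (k + 1) ^ n)
  by (unfold Rdiv; now rewrite Rpow_mult_distr, pow_inv).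
replace (INR (S n)
    * (x ^ S n / (Rpochhammer k (S n) * (INR (S n) * INR (fact n)))))
  with (x ^ S n / INR (fact n) * / Rpochhammer k (S n)) by (field; lra).
replace (x / k * (x ^ n / (k + 1) ^ n / INR (fact n)))
  with (x ^ S n / INR (fact n) * / (k * (k + 1) ^ n))
  by (rewrite <- tech_pow_Rmult; field; lra).
apply Rmult_le_compat_l.
- apply Rmult_le_pos; [now apply pow_le|now apply Rlt_le, Rinv_0_lt_compat].
- apply Rinv_le_contravar; [now apply Rmult_lt_0_compat|exact HP].
Qed.

(** For positive index, divide the weighted estimate by the index, which restores the factorial; at
    index 0 it reads 1 <= (k + 1) / k. *)
Lemma bessel_coef_le (k x : R) (n : nat) :
  0 < k -> 0 <= x ->
  bessel_coef k x n <= (k + 1) / k * ((x / (k + 1)) ^ n / INR (fact n)).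
Proof.
intros Hk Hx; destruct n as [|n].
- unfold bessel_coef; simpl.
  replace (1 / (1 * 1)) with (k / k) by (field; lra).
  replace ((k + 1) / k * (1 / 1)) with (k / k + / k) by (field; lra).
  assert (0 < / k) by now apply Rinv_0_lt_compat.
  lra.
- assert (Hn : 0 < INR (S n)) by (apply lt_0_INR; lia).
  apply Rmult_le_reg_l with (INR (S n)); [exact Hn|].
  eapply Rle_trans; [now apply bessel_coef_S_le|].
  right; rewrite fact_simpl, mult_INR, <- tech_pow_Rmult.
  assert (Hf := INR_fact_lt_0 n).
  field; lra.
Qed.

(** Induction by N + 1 <= 2 N for N >= 1. A geometric bound lets the quadratic weight be absorbed
    into an exponential series with argument multiplied by 4. *)
Lemma INR_S_sq_le_pow4 (n : nat) : INR (n + 1) ^ 2 <= 4 ^ n.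
Proof.
rewrite Nat.add_1_r; induction n as [|n IH]; [simpl; lra|].
rewrite (S_INR (S n)), <- (tech_pow_Rmult 4).
assert (H : 1 <= INR (S n)) by (apply (le_INR 1); lia).
nra.
Qed.

Lemma ex_series_bessel_coef_sq (k x : R) :
  0 < k -> 0 <= x ->
  ex_series (fun n => INR (n + 1) ^ 2 * bessel_coef k x n).
Proof.
intros Hk Hx.
destruct (is_series_le_ex (fun n => INR (n + 1) ^ 2 * bessel_coef k x n)
  (fun n => (k + 1) / k * ((4 * (x / (k + 1))) ^ n / INR (fact n)))
  ((k + 1) / k * exp (4 * (x / (k + 1))))) as [l [Hl _]]; [| |now exists l].
- intros n; assert (H := INR_S_sq_le_pow4 n).
  assert (H0 := bessel_coef_nonneg k x n Hk Hx).
  assert (H1 := bessel_coef_le k x n Hk Hx).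
  assert (H2 := pow2_ge_0 (INR (n + 1))).
  split; [now apply Rmult_le_pos|].
  rewrite Rpow_mult_distr.
  replace ((k + 1) / k * (4 ^ n * (x / (k + 1)) ^ n / INR (fact n)))
    with (4 ^ n * ((k + 1) / k * ((x / (k + 1)) ^ n / INR (fact n))))
    by (unfold Rdiv; ring).
  now apply Rmult_le_compat.
- apply (is_series_scal_l ((k + 1) / k) _ _ (is_series_exp _)).
Qed.

Lemma bessel_u_term (p b c z : C) (n : nat) :
  Im c = 0 -> Im (bessel_param p b) = 0 -> 0 < Re (bessel_param p b) ->
  ((- c) ^ n / Cpochhammer (bessel_param p b) n
      * (z ^ (n + 1) / RtoC (INR (fact n))))%C
  = (RtoC (bessel_coef (Re (bessel_param p b)) (- Re c) n) * z ^ (n + 1))%C.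
Proof.
intros Hc Hk0 Hk.
assert (Ek : bessel_param p b = RtoC (Re (bessel_param p b)))
  by (apply injective_projections; [reflexivity|exact Hk0]).
assert (Ec : (- c)%C = RtoC (- Re c)).
{ apply injective_projections; [reflexivity|].
  change (- Im c = 0); rewrite Hc; ring. }
assert (HP := Rpochhammer_pos _ n Hk).
assert (Hf := INR_fact_lt_0 n).
rewrite Ec, Ek at 1.
rewrite Cpochhammer_RtoC, <- RtoC_pow; unfold bessel_coef.
rewrite RtoC_div by nra; rewrite RtoC_mult.
field; split; intros H; apply RtoC_inj in H; lra.
Qed.

Theorem theorem1 (alpha beta : R) (p b c : C)
  (halpha : 0 <= alpha < 1) (hbeta : 0 < beta <= 1)
  (hc_real : Im c = 0) (hc_neg : Re c < 0)
  (hk_real : Im (bessel_param p b) = 0) (hk_pos : 0 < Re (bessel_param p b))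
  (hineq :
     let k := Re (bessel_param p b) in
     let E := exp (- Re c / (k + 1)) in
     2 * beta * (1 - alpha) * (2 - E + 1 / k * (1 - E))
       - (1 + beta) * (- Re c) / k * E >= 0) :
  class_Sstar alpha beta (bessel_u p b c).
Proof.
assert (Hterm := fun z n => bessel_u_term p b c z n hc_real hk_real hk_pos).
revert hineq hk_pos Hterm.
generalize (Re (bessel_param p b)) as k; intros k hineq Hk Hterm.
assert (Hx : 0 <= - Re c) by lra.
revert hineq Hterm Hx; generalize (- Re c) as x; intros x hineq Hterm Hx.
assert (Hpos := fun n => bessel_coef_nonneg k x n Hk Hx).
assert (Habs : forall n, Cmod (RtoC (bessel_coef k x n)) = bessel_coef k x n)
  by (intros n; rewrite Cmod_R; now apply Rabs_pos_eq).
assert (Hsq : ex_series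
    (fun n => INR (n + 1) ^ 2 * Cmod (RtoC (bessel_coef k x n)))).
{ eapply ex_series_ext; [|exact (ex_series_bessel_coef_sq k x Hk Hx)].
  intros n; now rewrite Habs. }
(* The majorant is the exponential series without its term of index 0, hence the [- 1]. *)
destruct (is_series_le_ex (fun n => bessel_coef k x (S n))
  (fun n => (k + 1) / k * ((x / (k + 1)) ^ S n / INR (fact (S n))))
  ((k + 1) / k * (exp (x / (k + 1)) - 1))) as [s [Hs Hsle]].
{ intros n; split; [apply Hpos|now apply bessel_coef_le]. }
{ apply (is_series_scal_l ((k + 1) / k)
    (fun n => (x / (k + 1)) ^ S n / INR (fact (S n)))).
  apply (is_series_incr_1 (fun n => (x / (k + 1)) ^ n / INR (fact n))).
  match goal with |- is_series _ ?y => replace y with (exp (x / (k + 1))) end.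
  - apply is_series_exp.
  - unfold plus; simpl; field; lra. }
destruct (is_series_le_ex (fun n => INR (S n) * bessel_coef k x (S n))
  (fun n => x / k * ((x / (k + 1)) ^ n / INR (fact n)))
  (x / k * exp (x / (k + 1)))) as [t [Ht Htle]].
{ intros n; split; [apply Rmult_le_pos; [apply pos_INR|apply Hpos]
    |now apply bessel_coef_S_le]. }
{ apply (is_series_scal_l (x / k) _ _ (is_series_exp _)). }
apply (class_Sstar_of_coef_bound alpha beta _
  (fun n => RtoC (bessel_coef k x n)) s t); try tauto.
- unfold bessel_coef; simpl; f_equal; field.
- intros z Hz.
  destruct (ex_Cseries_disc_bound (fun n => RtoC (bessel_coef k x n))
    (Series (fun n => Cmod (RtoC (bessel_coef k x n)))) z)
    as [l [Hl _]].
  + apply Series_correct.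
    (* Plain summability follows from [Hsq], whose weights are at least 1. *)
    apply (ex_series_le (K := R_AbsRing) (V := R_CompleteNormedModule) _
      (fun n => INR (n + 1) ^ 2 * Cmod (RtoC (bessel_coef k x n))));
      [|exact Hsq].
    intros n; change (Rabs (Cmod (RtoC (bessel_coef k x n)))
      <= INR (n + 1) ^ 2 * Cmod (RtoC (bessel_coef k x n))).
    assert (H0 := Cmod_ge_0 (RtoC (bessel_coef k x n))).
    rewrite Rabs_pos_eq by exact H0.
    assert (H1 : 1 <= INR (n + 1)) by (apply (le_INR 1); lia).
    assert (H2 : 1 <= INR (n + 1) ^ 2) by nra.
    nra.
  + now apply Rlt_le.
  (* [CSeries] is total, so convergence is established before [bessel_u] is identified with the
     sum. *)
  + assert (Hu := is_series_ext _ _ _ (fun n => eq_sym (Hterm z n)) Hl).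
    unfold bessel_u; now rewrite (CSeries_unique _ _ Hu).
- eapply is_series_ext; [|exact Hs]; intros n; symmetry; apply Habs.
- eapply is_series_ext; [|exact Ht]; intros n; simpl; now rewrite Habs.
- revert hineq Hsle Htle; simpl.
  generalize (exp (x / (k + 1))) as E; intros E hineq Hsle Htle.
  assert (H1 : (1 + beta) * t <= (1 + beta) * (x / k * E))
    by (apply Rmult_le_compat_l; lra).
  assert (H2 : 2 * beta * (1 - alpha) * s
    <= 2 * beta * (1 - alpha) * ((k + 1) / k * (E - 1)))
    by (apply Rmult_le_compat_l; [nra|exact Hsle]).
  (* In this form the hypothesis is the coefficient criterion with [s] and [t] replaced by their
     majorants. *)
  replace (2 - E + 1 / k * (1 - E)) with (1 - (k + 1) / k * (E - 1)) in hineq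
    by (field; lra).
  replace ((1 + beta) * x / k * E) with ((1 + beta) * (x / k * E)) in hineq
    by (field; lra).
  lra.
Qed.
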